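(* Let $n=2$. For $0\le t\le\frac1{\sqrt6}$ let $$a^{[t]}=\left(\tfrac12(\sqrt{2-3t^2}-t),\ t,\ -\tfrac12(t+\sqrt{2-3t^2})\right)\in S^2,$$ and for $\frac1{\sqrt6}<t\le\frac54\frac1{\sqrt6}$ let $$a^{\{t\}}=(\tilde a_1,b_+,b_-)\in S^2,\qquad \tilde a_1=t+\sqrt{t^2-\tfrac16},\qquad b_\pm=-\tfrac{\tilde a_1}{2}\pm\tfrac12\sqrt{2-3\tilde a_1^2}.$$ Then the extrema of $A(\cdot,t)$ over all $a\in S^2$ with $a_1+a_2+a_3=0$ are as follows. Maximum: (i) for $0\le t\le\frac1{\sqrt6}$, the maximum is attained at $a^{[t]}$ and $A(a^{[t]},t)=\sqrt3\,\frac1{\sqrt{2-3t^2}}$; (ii) for $\frac1{\sqrt6}<t\le\frac54\frac1{\sqrt6}$, the maximum is attained at $a^{\{t\}}$ and $A(a^{\{t\}},t)=\frac1{2\sqrt3}\,\frac1{t+\sqrt{t^2-1/6}}$; (iii) for $\frac54\frac1{\sqrt6}\le t<\sqrt{\frac23}$, the maximum is attained at $a^{(1)}$ and $A(a^{(1)},t)=\frac{2\sqrt2}{3}-\frac{2}{\sqrt3}t$. Minimum: for $0\le t\le\frac1{\sqrt6}$, the minimum is attained at $a^{(1)}$ and $A(a^{(1)},t)=\frac{2\sqrt2}{3}-\frac2{\sqrt3}t$.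
   Context: $\Delta^2=\{x\in\mathbb{R}^3: x_j\ge0,\ x_1+x_2+x_3=1\}$ is the regular triangle of side-length $\sqrt2$, $S^2=\{a\in\mathbb{R}^3:\sum_{j=1}^3a_j^2=1\}$. For $a\in S^2$ with $a_1+a_2+a_3=0$ and $t\in\mathbb{R}$, $A(a,t)=\mathrm{vol}_1(\{x\in\Delta^2:\langle a,x\rangle=t\})$ is the length of the section of $\Delta^2$ orthogonal to $a$ at distance $t$ from the centroid. $a^{(1)}=\frac1{\sqrt6}(2,-1,-1)$. *)

(* Defs.v *)
From HB Require Import structures.
From mathcomp Require Import all_boot all_order all_algebra.
From mathcomp Require Import ring lra.
From mathcomp Require Import all_classical all_reals all_analysis.

Set Implicit Arguments.
Unset Strict Implicit.
Unset Printing Implicit Defensive.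

Import Order.TTheory GRing.Theory Num.Theory.

Local Open Scope classical_set_scope.
Local Open Scope ring_scope.

Section TriangleSections.
Variable R : realType.
Implicit Types (a b x u p : 'rV[R]_3) (t : R).

Definition vec3 (x1 x2 x3 : R) : 'rV[R]_3 :=
  \row_(j < 3) nth 0 [:: x1; x2; x3] j.

Definition inner a x : R := \sum_(j < 3) a 0 j * x 0 j.

Definition triangle : set 'rV[R]_3 :=
  [set x | (forall j, 0 <= x 0 j) /\ \sum_(j < 3) x 0 j = 1].

Definition sphere2 : set 'rV[R]_3 := [set a | \sum_(j < 3) a 0 j ^+ 2 = 1].

Definition centered_dir : set 'rV[R]_3 :=
  [set a | sphere2 a /\ \sum_(j < 3) a 0 j = 0].

Definition triangle_section a t : set 'rV[R]_3 :=
  [set x | triangle x /\ inner a x = t].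

(* One-dimensional volume of the part of S on the line p + R u, where u is a
   Euclidean unit vector, so that s |-> p + s u is an isometry onto the line. *)
Definition vol1_line p u (S : set 'rV[R]_3) : \bar R :=
  lebesgue_measure [set s : R | S (p + s *: u)].

Definition centroid : 'rV[R]_3 := const_mx 3^-1.

(* The cross product of a with the unit normal (1,1,1)/sqrt 3 of the plane
   x_1 + x_2 + x_3 = 1. *)
Definition line_dir a : 'rV[R]_3 :=
  (Num.sqrt 3)^-1 *:
    vec3 (a 0 1 - a 0 2%:R) (a 0 2%:R - a 0 0) (a 0 0 - a 0 1).

(* For a in centered_dir, the lemmas line_dir_unit and
   triangle_section_sub_line below show that the whole section lies on the
   line used here, which has unit speed. *)
Definition section_length a t : \bar R :=
  vol1_line (centroid + t *: a) (line_dir a) (triangle_section a t).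

Definition is_maximizer t a : Prop :=
  centered_dir a /\ (forall b, centered_dir b -> (section_length b t <= section_length a t)%E).

Definition is_minimizer t a : Prop :=
  centered_dir a /\ (forall b, centered_dir b -> (section_length a t <= section_length b t)%E).

Definition a_one : 'rV[R]_3 := (Num.sqrt 6)^-1 *: vec3 2 (-1) (-1).

Definition a_bracket t : 'rV[R]_3 :=
  vec3 ((Num.sqrt (2 - 3 * t ^+ 2) - t) / 2)
       t
       (- ((t + Num.sqrt (2 - 3 * t ^+ 2)) / 2)).

Definition a_tilde1 t : R := t + Num.sqrt (t ^+ 2 - 6^-1).

Definition b_plus t : R :=
  - (a_tilde1 t / 2) + Num.sqrt (2 - 3 * a_tilde1 t ^+ 2) / 2.

Definition b_minus t : R :=
  - (a_tilde1 t / 2) - Num.sqrt (2 - 3 * a_tilde1 t ^+ 2) / 2.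

Definition a_brace t : 'rV[R]_3 := vec3 (a_tilde1 t) (b_plus t) (b_minus t).

Let sum3 (F : 'I_3 -> R) : \sum_(j < 3) F j = F 0 + F 1 + F 2%:R.
Proof.
rewrite !big_ord_recl big_ord0 addr0 addrA.
by congr (F _ + F _ + F _); apply/val_inj.
Qed.

Let row3P (x y : 'rV[R]_3) :
  x 0 0 = y 0 0 -> x 0 1 = y 0 1 -> x 0 2%:R = y 0 2%:R -> x = y.
Proof.
move=> h0 h1 h2; apply/rowP => -[[|[|[|//]]] i].
- by have -> : Ordinal i = 0 by apply/val_inj.
- by have -> : Ordinal i = 1 by apply/val_inj.
- by have -> : Ordinal i = 2%:R by apply/val_inj.
Qed.

Let sqrt3 : (Num.sqrt 3 : R)^-1 ^+ 2 = 3^-1.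
Proof. by rewrite exprVn sqr_sqrtr. Qed.

Lemma line_dir_unit a : centered_dir a -> sphere2 (line_dir a).
Proof.
rewrite /centered_dir /sphere2 /= !sum3 !mxE /= => -[h1 h0].
rewrite !exprMn sqrt3 -!mulrDr.
set p := a 0 0 in h0 h1 *; set q := a 0 1 in h0 h1 *.
set r := a 0 2%:R in h0 h1 *.
have -> : (q - r) ^+ 2 + (r - p) ^+ 2 + (p - q) ^+ 2 =
  3 * (p ^+ 2 + q ^+ 2 + r ^+ 2) - (p + q + r) ^+ 2 by ring.
by rewrite h1 h0 expr0n subr0 mulr1 mulVf.
Qed.

Lemma triangle_section_sub_line a t : centered_dir a ->
  triangle_section a t `<=`
  [set centroid + t *: a + s *: line_dir a | s in [set: R]].
Proof.
move=> [] /[swap]; rewrite /sphere2 /= !sum3 => h0 h1 x [[_]].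
rewrite /inner !sum3 => hx ht.
exists (inner (line_dir a) x) => //; symmetry.
have e3 := sqrt3.
set k := (Num.sqrt 3)^-1 in e3.
apply: row3P; rewrite /inner /line_dir sum3 !mxE /= -/k.
all: move: h0 h1 hx ht.
all: set p := a 0 0; set q := a 0 1; set r := a 0 2%:R.
all: set X := x 0 0; set Y := x 0 1; set Z := x 0 2%:R.
all: move=> h0 h1 hx ht.
all: have er : r = - p - q by lra.
all: have eZ : Z = 1 - X - Y by lra.
all: have pq : 1 - 2 * (p ^+ 2 + q ^+ 2 + p * q) = 0
       by move: h1; rewrite er; lra.
all: have k0 : 3^-1 - k ^+ 2 = 0 by rewrite e3 subrr.
all: rewrite -ht er eZ; set D := k * _ * X + k * _ * Y + k * _ * _.
all: apply/eqP; rewrite -subr_eq0; apply/eqP.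
- transitivity ((X - 3^-1) * (1 - 2 * (p ^+ 2 + q ^+ 2 + p * q)) +
    (3^-1 - k ^+ 2) * ((p + 2 * q) *
      ((p + 2 * q) * X - (2 * p + q) * Y + (p - q) * (1 - X - Y)))).
    by rewrite /D; field.
  by rewrite pq k0 mulr0 mul0r addr0.
- transitivity ((Y - 3^-1) * (1 - 2 * (p ^+ 2 + q ^+ 2 + p * q)) +
    (3^-1 - k ^+ 2) * (- (2 * p + q) *
      ((p + 2 * q) * X - (2 * p + q) * Y + (p - q) * (1 - X - Y)))).
    by rewrite /D; field.
  by rewrite pq k0 mulr0 mul0r addr0.
- transitivity ((1 - X - Y - 3^-1) * (1 - 2 * (p ^+ 2 + q ^+ 2 + p * q)) +
    (3^-1 - k ^+ 2) * ((p - q) *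
      ((p + 2 * q) * X - (2 * p + q) * Y + (p - q) * (1 - X - Y)))).
    by rewrite /D; field.
  by rewrite pq k0 mulr0 mul0r addr0.
Qed.

End TriangleSections.

(* Main.v *)
Require Import Defs.
From mathcomp Require Import all_boot all_order all_algebra.
From mathcomp Require Import ring lra.
From mathcomp Require Import all_classical all_reals all_analysis.

Import Order.TTheory GRing.Theory Num.Theory.
Local Open Scope ring_scope.

(** Write p >= q >= r for the coordinates of a direction a in decreasing order.
    They are the heights, measured from the centroid in direction a, of the
    three vertices, and the constraints p + q + r = 0, p^2 + q^2 + r^2 = 1 leave
    one degree of freedom.  As a function of t the length of the section is zero
    outside [r, p] and linear on [r, q] and on [q, p].  On the upper piece it is
    [cut_length p t] = (p - t) / (sqrt 3 (p^2 - 1/6)), which depends on the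
    extreme height p alone ([measure_chord]); the lower piece follows from it by
    a -> - a, t -> - t ([measure_chord_low]).  So every section at height
    t >= 0 is empty or has length [cut_length z tau] with tau = t or tau = - t
    and h < z <= 2 h, where h = 1 / sqrt 6, and the second sign occurs only for
    t <= h ([section_length_cases]).  What is left is to optimise this function
    of z.

    For |tau| <= h the constraint that matters is that tau is not between the
    two other heights: w := z^2 + z tau + tau^2 - 1/2 >= 0.  Since
      3 z^2 - 1/2 = (z - tau) (2 z + tau) + w,
      2 - 3 tau^2 = (2 z + tau)^2 - 4 w,
    one gets (z - tau) sqrt (2 - 3 tau^2) <= 3 z^2 - 1/2, with equality for
    w = 0, in particular when the height of the middle vertex is tau
    ([cut_length_le_mid]).

    For t > h the function z |-> [cut_length z t] is maximal at its critical
    point z0 = t + sqrt (t^2 - 1/6), the bound being equivalent to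
    (z - z0)^2 >= 0 ([cut_length_le_far]).  This point is admissible as long as
    z0 <= 2 h, that is t <= 5/4 h; for larger t the function increases up to
    z = 2 h ([cut_length_le_end]).  For t <= h it decreases in z, and the choice
    tau = - t only lengthens the section, so z = 2 h with tau = t gives the
    minimum ([cut_length_ge_end]). *)

Section Chords.
Set Implicit Arguments.
Unset Strict Implicit.
Unset Printing Implicit Defensive.
Variable R : realType.
Local Open Scope classical_set_scope.
Implicit Types (p q r s t z w tau kappa : R) (a b : 'rV[R]_3).

Local Notation h := (Num.sqrt 6)^-1.
Local Notation mu := (@lebesgue_measure R).

(** * Vertex heights and chords *)

Lemma h_gt0 : 0 < h :> R. Proof. by rewrite invr_gt0 sqrtr_gt0. Qed.
Lemma h_sqr : h ^+ 2 = 6^-1 :> R.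
Proof. by rewrite exprVn sqr_sqrtr. Qed.

Lemma sqrt3_gt0 : 0 < Num.sqrt 3 :> R. Proof. by rewrite sqrtr_gt0. Qed.
Lemma sqrt3_sqr : Num.sqrt 3 ^+ 2 = 3 :> R.
Proof. by rewrite sqr_sqrtr. Qed.

Lemma norm_invsqrt3 : `|(Num.sqrt 3)^-1| = (Num.sqrt 3)^-1 :> R.
Proof. by rewrite gtr0_norm// invr_gt0 sqrt3_gt0. Qed.

Definition centered_triple p q r :=
  p + q + r = 0 /\ p ^+ 2 + q ^+ 2 + r ^+ 2 = 1.

(** The parameters s for which the point at height t with displacement s along
    the section has nonnegative barycentric coordinates.  The direction is
    kappa (q - r, r - p, p - q); kappa = 1 / sqrt 3 gives [line_dir].  The sign
    of kappa is left free because an odd permutation of the vertices reverses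
    the direction. *)
Definition chord kappa p q r t : set R :=
  [set s | [/\ 0 <= 3^-1 + t * p + s * (kappa * (q - r)),
               0 <= 3^-1 + t * q + s * (kappa * (r - p))
             & 0 <= 3^-1 + t * r + s * (kappa * (p - q))]].

Lemma sum3 (V : nmodType) (f : 'I_3 -> V) :
  \sum_(j < 3) f j = f 0 + f 1 + f 2%:R.
Proof.
rewrite !big_ord_recl big_ord0 addr0 addrA.
by congr (f _ + f _ + f _); apply/val_inj.
Qed.

Lemma forall3 (P : 'I_3 -> Prop) : (forall j, P j) <-> [/\ P 0, P 1 & P 2%:R].
Proof.
split=> [H|[H0 H1 H2] [[|[|[|//]]] i]]; first by split.
- by have -> : Ordinal i = 0 by apply/val_inj.
- by have -> : Ordinal i = 1 by apply/val_inj.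
- by have -> : Ordinal i = 2%:R by apply/val_inj.
Qed.

Lemma centered_dirE a :
  centered_dir a <-> centered_triple (a 0 0) (a 0 1) (a 0 2%:R).
Proof.
by rewrite /centered_dir /sphere2 /centered_triple /= !sum3; split=> -[].
Qed.

(** The sum of the coordinates and the height are constant along the line, so
    only the sign conditions on the coordinates remain. *)
Lemma section_length_chord a t : centered_dir a ->
  section_length a t =
  mu (chord (Num.sqrt 3)^-1 (a 0 0) (a 0 1) (a 0 2%:R) t).
Proof.
move/centered_dirE => [a0 a1]; rewrite /section_length /vol1_line.
congr (mu _); apply/funext => s; apply/propext.
rewrite /triangle_section /triangle /chord /inner /= forall3 !sum3 !mxE /=.
split=> [[[]]//|H].
move: a0 a1 H; move: (a 0 0) (a 0 1) (a 0 2%:R) => p q r.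
move=> a0 a1 H; do 2?split=> //.
  transitivity (3 * 3^-1 + t * (p + q + r)); first by ring.
  by rewrite a0; field.
transitivity (3^-1 * (p + q + r) + t * (p ^+ 2 + q ^+ 2 + r ^+ 2)).
  by ring.
by rewrite a0 a1; ring.
Qed.

Lemma chord_cyc kappa p q r t : chord kappa p q r t = chord kappa q r p t.
Proof. by apply/funext => s; apply/propext; split=> -[]. Qed.

Lemma chord_swap kappa p q r t : chord kappa p q r t = chord (- kappa) p r q t.
Proof.
apply/funext => s; apply/propext.
by rewrite /chord /= !mulNr -!mulrN !opprB; split=> -[].
Qed.

(** Reflecting the direction and the height together leaves the cutting line
    unchanged; only the orientation of its parametrisation changes. *)
Lemma chord_opp kappa p q r t :
  chord kappa p q r t = chord (- kappa) (- p) (- q) (- r) (- t).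
Proof.
apply/funext => s; apply/propext.
by rewrite /chord /= !mulrNN !mulNr -!mulrN -!opprD !opprK.
Qed.

Lemma chord_sort kappa p q r t : centered_triple p q r ->
  exists kappa' p' q' r', [/\ centered_triple p' q' r', r' <= q', q' <= p',
    `|kappa'| = `|kappa| & chord kappa p q r t = chord kappa' p' q' r' t].
Proof.
have rot x y z : centered_triple x y z -> centered_triple y z x.
  by case=> e0 e1; split; lra.
have swp x y z : centered_triple x y z -> centered_triple x z y.
  by case=> e0 e1; split; lra.
have max_first x y z : centered_triple x y z -> y <= x -> z <= x ->
  exists kappa' p' q' r', [/\ centered_triple p' q' r', r' <= q', q' <= p',
    `|kappa'| = `|kappa| & chord kappa x y z t = chord kappa' p' q' r' t].
  move=> C yx zx; have [zy|/ltW yz] := leP z y.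
    by exists kappa, x, y, z.
  exists (- kappa), x, z, y; rewrite normrN -chord_swap.
  by split=> //; apply: swp.
move=> C; have [qp|/ltW pq] := leP q p; have [rp|/ltW pr] := leP r p.
- exact: max_first.
- rewrite -chord_cyc; apply: max_first => //; first exact/rot/rot.
  exact: le_trans pr.
- by rewrite chord_cyc; apply: max_first => //; [exact: rot|exact: le_trans pq].
- have [rq|/ltW qr] := leP r q.
    by rewrite chord_cyc; apply: max_first => //; exact: rot.
  by rewrite -chord_cyc; apply: max_first => //; exact/rot/rot.
Qed.

(** * Length of a chord *)

Lemma measure_scaled_itv kappa lo hi : kappa != 0 -> lo <= hi ->
  mu [set s | lo <= kappa * s /\ kappa * s <= hi] = ((hi - lo) / `|kappa|)%:E.
Proof.
move=> k0 lh; have segE m M : m <= M -> mu `[m, M] = (M - m)%:E.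
  move=> mM; rewrite [LHS](lebesgue_measure_itv `[m, M]%R) /= lte_fin.
  by case: ltgtP mM => // -> _; rewrite subrr.
have [kn|kp] : kappa < 0 \/ 0 < kappa by apply/orP; rewrite -neq_lt.
  have -> : [set s | lo <= kappa * s /\ kappa * s <= hi] =
      `[hi / kappa, lo / kappa].
    apply/seteqP; split=> s /=; rewrite in_itv /= ler_ndivrMr// ler_ndivlMr//.
      by rewrite mulrC => -[-> ->].
    by rewrite mulrC => /andP[].
  rewrite segE ?ler_nM2r ?invr_lt0//; congr EFin.
  by rewrite ltr0_norm// invrN mulrN -mulrBl -mulNr opprB.
have -> : [set s | lo <= kappa * s /\ kappa * s <= hi] =
    `[lo / kappa, hi / kappa].
  apply/seteqP; split=> s /=; rewrite in_itv /= ler_pdivrMr// ler_pdivlMr//.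
    by rewrite mulrC => -[-> ->].
  by rewrite mulrC => /andP[].
by rewrite segE ?ler_pM2r ?invr_gt0//; rewrite gtr0_norm// mulrBl.
Qed.

(** The displacement v has been eliminated between the coordinates of the two
    lower vertices: v enters them with weights r - p and p - q.  It gives the
    length of the chord, and its emptiness above the top vertex. *)
Lemma chord_balance p q r t v : centered_triple p q r ->
  (3^-1 + t * q + v * (r - p)) * (p - q) +
  (3^-1 + t * r + v * (p - q)) * (p - r) = p - t.
Proof.
move=> [e0 e1].
transitivity (p - (p + q + r) / 3 + t * p * (p + q + r)
  - t * (p ^+ 2 + q ^+ 2 + r ^+ 2)); first by field.
by rewrite e0 e1; field.
Qed.

(** Above the middle vertex the coordinate of the top vertex is nonnegative as
    soon as the one of the bottom vertex is: a section at such a height does not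
    meet the edge opposite to the top vertex, except in the middle vertex. *)
Lemma chord_top_coordinate p q r t v : centered_triple p q r ->
  (3^-1 + t * p + v * (q - r)) * (p - q) =
  (3^-1 + t * r + v * (p - q)) * (q - r) + (t - q).
Proof.
move=> [e0 e1]; apply/eqP; rewrite -subr_eq0; apply/eqP.
transitivity ((p + q + r) / 3 - t * q * (p + q + r)
  + t * (p ^+ 2 + q ^+ 2 + r ^+ 2 - 1)); first by field.
by rewrite e0 e1; field.
Qed.

Lemma apex_factor p q r : centered_triple p q r ->
  (p - q) * (p - r) = 3 * (p ^+ 2 - 6^-1).
Proof.
move=> [e0 e1]; have er : r = - p - q by lra.
have : 2 * (p ^+ 2 + q ^+ 2 + p * q) = 1 by move: e1; rewrite er; lra.
by rewrite er; lra.
Qed.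

Lemma chord_empty kappa p q r t : centered_triple p q r ->
  r <= q -> q <= p -> p < t -> chord kappa p q r t = set0.
Proof.
move=> C rq qp pt; apply/seteqP; split=> // s [_ h2 h3].
have := chord_balance t (s * kappa) C; rewrite -!(mulrA s) => e.
have : 0 <= p - t.
  by rewrite -e addr_ge0// mulr_ge0// subr_ge0// (le_trans rq).
by rewrite leNgt subr_lt0 pt.
Qed.

(** Let z >= q >= r be the heights of the three vertices.  Between the heights q
    and z the length of the section is linear and vanishes at z; as the area of
    the triangle is sqrt 3 / 2, its value at q is sqrt 3 / (z - r).  Hence it is
    sqrt 3 (z - tau) / ((z - q) (z - r)) at height tau, and [apex_factor]
    removes q and r. *)
Definition cut_length z tau : R := (z - tau) / (Num.sqrt 3 * (z ^+ 2 - 6^-1)).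

(** Each of the two edges at the top vertex p carries one end of the section:
    the end conditions are the vanishing of the barycentric coordinates of the
    two other vertices. *)
Lemma measure_chord kappa p q r t : centered_triple p q r ->
  `|kappa| = (Num.sqrt 3)^-1 -> r <= q -> q < p -> q <= t -> t <= p ->
  mu (chord kappa p q r t) = (cut_length p t)%:E.
Proof.
move=> C k rq qp qt tp.
have d1 : 0 < p - q by rewrite subr_gt0.
have d2 : 0 < p - r by rewrite subr_gt0; exact: le_lt_trans qp.
set lo := - (3^-1 + t * r) / (p - q); set hi := (3^-1 + t * q) / (p - r).
have -> : chord kappa p q r t =
    [set s | lo <= kappa * s /\ kappa * s <= hi].
  apply/funext => s; apply/propext.
  rewrite /chord /= !mulrA (mulrC s); move: (kappa * s) => v.
  rewrite /lo /hi ler_pdivrMr// ler_pdivlMr//.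
  split=> [[_ x2 x3]|[x3 x2]]; first by split; lra.
  split; [|lra|lra].
  have x3' : 0 <= 3^-1 + t * r + v * (p - q) by lra.
  rewrite -(pmulr_lge0 _ d1) (chord_top_coordinate _ _ C).
  by rewrite addr_ge0 ?mulr_ge0 ?subr_ge0.
have hl : hi - lo = (p - t) / (3 * (p ^+ 2 - 6^-1)).
  rewrite -(apex_factor C) -(chord_balance t 0 C) /hi /lo.
  by field; rewrite !gt_eqF.
have X0 : 0 < 3 * (p ^+ 2 - 6^-1) by rewrite -(apex_factor C) mulr_gt0.
rewrite measure_scaled_itv.
- rewrite hl k /cut_length invrK; congr EFin.
  have s0 := sqrt3_gt0; have := sqrt3_sqr.
  move: (Num.sqrt 3) s0 => u u0 u2.
  have X1 : 0 < p ^+ 2 - 6^-1 by lra.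
  rewrite -u2; field; rewrite !gt_eqF//; lra.
- by rewrite -normr_gt0 k invr_gt0 sqrt3_gt0.
- by rewrite -subr_ge0 hl divr_ge0 ?subr_ge0 ?(ltW X0).
Qed.

Lemma centered_triple_opp p q r :
  centered_triple p q r -> centered_triple (- r) (- q) (- p).
Proof. by case=> e0 e1; split; lra. Qed.

(** The case of the lower piece, by the reflection p, q, r, t -> - r, - q, - p,
    - t. *)
Lemma measure_chord_low kappa p q r t : centered_triple p q r ->
  `|kappa| = (Num.sqrt 3)^-1 -> q <= p -> r < q -> r <= t -> t <= q ->
  mu (chord kappa p q r t) = (cut_length (- r) (- t))%:E.
Proof.
move=> C k qp rq rt tq.
rewrite chord_opp chord_swap opprK chord_cyc.
by rewrite measure_chord ?lerN2 ?ltrN2//; first exact: centered_triple_opp.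
Qed.

(** * The one-parameter family of sections *)

(** The other two heights q, r satisfy q + r = - z and q r = z^2 - 1/2, so the
    last inequality says (tau - q) (tau - r) >= 0. *)
Definition apex_range z tau :=
  [/\ h < z, z <= 2 * h, tau <= z & 2^-1 <= z ^+ 2 + z * tau + tau ^+ 2].

Lemma top_le p q r : centered_triple p q r -> p <= 2 * h.
Proof.
move=> [e0 e1]; have h0 := h_gt0; have h2 := h_sqr.
by have := sqr_ge0 (q - r); nra.
Qed.

Lemma top_ge p q r : centered_triple p q r -> r <= q -> q <= p -> h <= p.
Proof.
move=> C rq qp; have h0 := h_gt0; have h2 := h_sqr.
have := apex_factor C; case: C => e0 e1; nra.
Qed.

Lemma apex_range_sorted p q r t : centered_triple p q r ->
  r <= q -> q < p -> q <= t -> t <= p -> apex_range p t.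
Proof.
move=> C rq qp qt tp; have h0 := h_gt0; have h2 := h_sqr.
have hp := top_ge C rq (ltW qp); have af := apex_factor C.
split=> //; [|exact: top_le C|].
  by rewrite lt_neqAle hp andbT; apply/eqP => e; move: af; rewrite -e; nra.
by case: C => e0 e1; nra.
Qed.

(** The condition on the sign: the lower piece is reached at height t only if
    t <= q, and the middle height q never exceeds h. *)
Lemma section_length_cases b t : centered_dir b -> 0 <= t ->
  (h < t /\ section_length b t = 0%E) \/
  exists z tau, [/\ apex_range z tau, tau = t \/ tau = - t /\ t <= h
    & section_length b t = (cut_length z tau)%:E].
Proof.
move=> Cb t0; rewrite (section_length_chord t Cb).
move/centered_dirE: Cb => /(chord_sort (Num.sqrt 3)^-1 t).
move=> [k [p [q [r [C rq qp + ->]]]]].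
rewrite norm_invsqrt3 => nk.
have [tq|qt] := leP t q.
  right; exists (- r), (- t).
  (* r = q >= 0 would make all three heights vanish *)
  have rq' : r < q.
    rewrite lt_neqAle rq andbT; apply/eqP => e.
    by case: C => e0 e1; nra.
  have rt : r <= t by case: C => e0 e1; nra.
  have qh : q <= h.
    by have h0 := h_gt0; have h2 := h_sqr; case: C => e0 e1; nra.
  split; [|by right; split=> //; exact: le_trans qh|exact: measure_chord_low].
  by apply: (apex_range_sorted (centered_triple_opp C)); rewrite ?lerN2 ?ltrN2.
have [tp|pt] := leP t p.
  right; exists p, t; have qp' := lt_le_trans qt tp.
  split; [exact: (apex_range_sorted C rq qp' (ltW qt) tp)|by left|].
  by apply: measure_chord => //; exact: ltW.
left; split; first exact: le_lt_trans (top_ge C rq qp) pt.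
by rewrite (chord_empty _ C)// measure0.
Qed.

(** * Optimising over the height of the apex *)

Lemma cut_lengthE z tau :
  cut_length z tau = (z - tau) / (z ^+ 2 - 6^-1) / Num.sqrt 3.
Proof. by rewrite /cut_length invfM mulrA mulrAC. Qed.

Lemma apex_pos z : h < z -> 0 < z ^+ 2 - 6^-1.
Proof. by move=> hz; have h0 := h_gt0; have h2 := h_sqr; nra. Qed.

Lemma cut_length_le z tau c : h < z ->
  z - tau <= c * (z ^+ 2 - 6^-1) -> cut_length z tau <= c / Num.sqrt 3.
Proof.
move=> /apex_pos X0 H.
by rewrite cut_lengthE ler_pM2r ?invr_gt0 ?sqrt3_gt0// ler_pdivrMr.
Qed.

Lemma cut_length_ge z tau c : h < z ->
  c * (z ^+ 2 - 6^-1) <= z - tau -> c / Num.sqrt 3 <= cut_length z tau.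
Proof.
move=> /apex_pos X0 H.
by rewrite cut_lengthE ler_pM2r ?invr_gt0 ?sqrt3_gt0// ler_pdivlMr.
Qed.

(** Equality holds when tau is the height of one of the two lower vertices; the
    inequality combines sqrt (2 - 3 tau^2) <= 2 z + tau with w >= 0 for
    w = z^2 + z tau + tau^2 - 1/2. *)
Lemma cut_length_le_mid z tau : apex_range z tau -> - h <= tau -> tau <= h ->
  cut_length z tau <= Num.sqrt 3 / Num.sqrt (2 - 3 * tau ^+ 2).
Proof.
move=> [hz _ tz w] t1 t2; have h0 := h_gt0; have h2 := h_sqr.
have D0 : 0 < Num.sqrt (2 - 3 * tau ^+ 2) by rewrite sqrtr_gt0; nra.
have D2 : Num.sqrt (2 - 3 * tau ^+ 2) ^+ 2 = 2 - 3 * tau ^+ 2.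
  by rewrite sqr_sqrtr//; nra.
move: (Num.sqrt _) D0 D2 => D D0 D2.
have s3 := sqrt3_sqr; have s30 := sqrt3_gt0.
have -> : Num.sqrt 3 / D = 3 / D / Num.sqrt 3.
  by rewrite -[X in X / D / _]s3; field; rewrite !gt_eqF.
apply: cut_length_le => //; rewrite mulrAC ler_pdivlMr//.
have DL : D <= 2 * z + tau.
  have zt : 0 <= 2 * z + tau by lra.
  by rewrite -(@ler_pXn2r _ 2) ?nnegrE ?(ltW D0)// D2; lra.
have : (z - tau) * D <= (z - tau) * (2 * z + tau).
  by rewrite ler_wpM2l// subr_ge0.
by lra.
Qed.

(** With z0 = [a_tilde1 t] one has z0^2 - 2 t z0 + 1/6 = 0, and then
    (z^2 - 1/6) - 2 z0 (z - t) = (z - z0)^2. *)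
Lemma cut_length_le_far z t : h < z -> h < t ->
  cut_length z t <= (2 * Num.sqrt 3)^-1 / a_tilde1 t.
Proof.
move=> hz ht; have h0 := h_gt0; have h2 := h_sqr.
have r2 : Num.sqrt (t ^+ 2 - 6^-1) ^+ 2 = t ^+ 2 - 6^-1.
  by rewrite sqr_sqrtr// ltW// apex_pos.
have r0 := sqrtr_ge0 (t ^+ 2 - 6^-1).
rewrite /a_tilde1; move: (Num.sqrt (_ - _)) r2 r0 => e e2 e0.
have te : 0 < t + e by lra.
have -> : (2 * Num.sqrt 3)^-1 / (t + e) = (2 * (t + e))^-1 / Num.sqrt 3.
  by field; rewrite !gt_eqF// sqrt3_gt0.
apply: cut_length_le => //; rewrite mulrC ler_pdivlMr; last by lra.
have := sqr_ge0 (z - (t + e)); nra.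
Qed.

Lemma sqrt23 : Num.sqrt (2 / 3) = 2 * h :> R.
Proof.
have h0 := h_gt0.
have -> : 2 / 3 = (2 * h) ^+ 2 :> R by rewrite exprMn h_sqr; field.
by rewrite sqrtr_sqr ger0_norm//; lra.
Qed.

Lemma a_one_value t :
  2 * Num.sqrt 2 / 3 - 2 / Num.sqrt 3 * t = 2 * (2 * h - t) / Num.sqrt 3 :> R.
Proof.
have s0 := sqrt3_gt0; have s2 := sqrt3_sqr.
have -> : Num.sqrt 2 = Num.sqrt 3 * (2 * h) :> R.
  by rewrite -sqrt23 -sqrtrM//; congr Num.sqrt; field.
rewrite -[X in _ / X - _]s2.
by field; rewrite !gt_eqF.
Qed.

(** After multiplication by the denominator this is the excess of the length at
    apex height 2 h over the one at z <= 2 h.  The factor that decides its sign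
    is nonnegative for 5/4 h <= t <= 2 h and nonpositive for t <= h, since
    z + 2 h lies between 3 h and 4 h and 6 h^2 = 1. *)
Lemma end_gap z t : (2 * h - z) * (1 - 2 * (2 * h - t) * (z + 2 * h)) =
  2 * (2 * h - t) * (z ^+ 2 - 6^-1) - (z - t).
Proof.
have e6 : 6^-1 = h ^+ 2 :> R by rewrite h_sqr.
have : 6 * h ^+ 2 = 1 :> R by rewrite -e6; field.
rewrite e6; move: h => g e.
apply/eqP; rewrite -subr_eq0; apply/eqP.
by transitivity ((2 * g - t) * (1 - 6 * g ^+ 2)); [ring|rewrite e subrr mulr0].
Qed.

Lemma cut_length_le_end z t : h < z -> z <= 2 * h -> 5 / 4 * h <= t ->
  t <= 2 * h -> cut_length z t <= 2 * (2 * h - t) / Num.sqrt 3.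
Proof.
move=> hz z2 ht t2; have h0 := h_gt0; have h2 := h_sqr.
apply: cut_length_le => //; rewrite -subr_ge0 -end_gap mulr_ge0 ?subr_ge0//.
have : (2 * h - t) * (z + 2 * h) <= (3 / 4 * h) * (4 * h).
  by apply: ler_pM; lra.
by lra.
Qed.

Lemma cut_length_ge_end z tau t : h < z -> z <= 2 * h -> t <= h -> tau <= t ->
  2 * (2 * h - t) / Num.sqrt 3 <= cut_length z tau.
Proof.
move=> hz z2 th taut; have h0 := h_gt0; have h2 := h_sqr.
apply: cut_length_ge => //; apply: (@le_trans _ _ (z - t)); last by lra.
rewrite -subr_le0 -end_gap mulr_ge0_le0 ?subr_ge0// subr_le0.
have : h * (3 * h) <= (2 * h - t) * (z + 2 * h).
  by apply: ler_pM; lra.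
by lra.
Qed.

(** * The extremal directions *)

Lemma a_one_triple : centered_triple (2 * h) (- h) (- h).
Proof. by have h2 := h_sqr; split; lra. Qed.

Lemma a_one_centered : centered_dir (a_one R).
Proof.
apply/centered_dirE; rewrite !mxE /= !mulrN1 (mulrC _ 2); exact: a_one_triple.
Qed.

Lemma section_length_a_one t : 0 <= t -> t <= 2 * h ->
  section_length (a_one R) t = (2 * (2 * h - t) / Num.sqrt 3)%:E.
Proof.
move=> t0 t2; have h0 := h_gt0; have h2 := h_sqr.
rewrite (section_length_chord t a_one_centered) !mxE /= !mulrN1 (mulrC _ 2).
rewrite (measure_chord a_one_triple) ?norm_invsqrt3//; [|lra|lra].
rewrite cut_lengthE exprMn h_sqr; congr EFin; field.
by rewrite !gt_eqF.
Qed.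

Lemma vec3_centeredE p q r :
  centered_dir (vec3 p q r) <-> centered_triple p q r.
Proof. by rewrite centered_dirE !mxE. Qed.

Lemma section_length_vec3 p q r t : centered_triple p q r ->
  section_length (vec3 p q r) t = mu (chord (Num.sqrt 3)^-1 p q r t).
Proof.
by move/vec3_centeredE => C; rewrite (section_length_chord t C) !mxE.
Qed.

(** The middle vertex is at height t: by [measure_chord_low], and not by
    [measure_chord], because for t = h the middle vertex reaches the top one and
    the section becomes an edge. *)
Lemma section_length_a_bracket t : 0 <= t -> t <= h ->
  centered_dir (a_bracket t) /\
  section_length (a_bracket t) t = (Num.sqrt 3 / Num.sqrt (2 - 3 * t ^+ 2))%:E.
Proof.
move=> t0 th; have h0 := h_gt0; have h2 := h_sqr.
rewrite /a_bracket.
have D0 : 0 < Num.sqrt (2 - 3 * t ^+ 2) by rewrite sqrtr_gt0; nra.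
have D2 : Num.sqrt (2 - 3 * t ^+ 2) ^+ 2 = 2 - 3 * t ^+ 2.
  by rewrite sqr_sqrtr//; nra.
move: (Num.sqrt (2 - _)) D0 D2 => D D0 D2.
have C : centered_triple ((D - t) / 2) t (- ((t + D) / 2)) by split; lra.
have D3 : 3 * t <= D.
  rewrite -(@ler_pXn2r _ 2) ?nnegrE ?(ltW D0)//; last by lra.
  by rewrite D2; nra.
split; first exact/vec3_centeredE.
rewrite (section_length_vec3 t C) (measure_chord_low C) ?norm_invsqrt3//;
  [|lra|lra|lra].
congr EFin; rewrite opprK cut_lengthE opprK.
(* the case w = 0 of the identity for 3 z^2 - 1/2 with z = (t + D) / 2 *)
have fac : ((t + D) / 2) ^+ 2 - 6^-1 = ((t + D) / 2 + t) * D / 3 by lra.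
have s0 := sqrt3_gt0; have s2 := sqrt3_sqr.
have D4 : 0 < 3 * t + D by lra.
have -> : Num.sqrt 3 / D = 3 / D / Num.sqrt 3.
  by rewrite -[X in X / D / _]s2; field; rewrite !gt_eqF.
rewrite fac; field.
by rewrite !gt_eqF//; lra.
Qed.

Lemma a_tilde1_le t : h < t -> t <= 5 / 4 * h -> a_tilde1 t <= 2 * h.
Proof.
move=> ht t5; have h0 := h_gt0; have h2 := h_sqr; rewrite /a_tilde1.
have : Num.sqrt (t ^+ 2 - 6^-1) <= 2 * h - t.
  have u0 : 0 <= 2 * h - t by lra.
  by rewrite -(ger0_norm u0) -sqrtr_sqr ler_wsqrtr//; nra.
by lra.
Qed.

(** The top height is the critical point z0, and the middle height stays below
    h < t because sqrt (2 - 3 z0^2) <= 3 h. *)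
Lemma section_length_a_brace t : h < t -> t <= 5 / 4 * h ->
  centered_dir (a_brace t) /\
  section_length (a_brace t) t = ((2 * Num.sqrt 3)^-1 / a_tilde1 t)%:E.
Proof.
move=> ht t5; have h0 := h_gt0; have h2 := h_sqr.
have zle := a_tilde1_le ht t5.
have r2 : Num.sqrt (t ^+ 2 - 6^-1) ^+ 2 = t ^+ 2 - 6^-1.
  by rewrite sqr_sqrtr// ltW// apex_pos.
have zt : t <= a_tilde1 t by rewrite lerDl sqrtr_ge0.
have zE : a_tilde1 t ^+ 2 = 2 * t * a_tilde1 t - 6^-1 by rewrite /a_tilde1; lra.
rewrite /a_brace /b_plus /b_minus.
move: (a_tilde1 t) zle zt zE => z zle zt zE.
have D0 : 0 <= Num.sqrt (2 - 3 * z ^+ 2) by rewrite sqrtr_ge0.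
have D2 : Num.sqrt (2 - 3 * z ^+ 2) ^+ 2 = 2 - 3 * z ^+ 2.
  by rewrite sqr_sqrtr//; nra.
move: (Num.sqrt (2 - _)) D0 D2 => D D0 D2.
have C : centered_triple z (- (z / 2) + D / 2) (- (z / 2) - D / 2).
  by split; lra.
have D3 : D <= 3 * h.
  by rewrite -(@ler_pXn2r _ 2) ?nnegrE//; nra.
split; first exact/vec3_centeredE.
rewrite (section_length_vec3 t C) (measure_chord C) ?norm_invsqrt3//;
  [|lra|lra|lra].
congr EFin; rewrite cut_lengthE.
(* a rewriting of the critical point equation z^2 - 2 t z + 1/6 = 0 *)
have X : z ^+ 2 - 6^-1 = 2 * z * (z - t) by lra.
have zt' : t < z.
  have : 0 < z ^+ 2 - 6^-1 by apply: apex_pos; lra.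
  by rewrite X pmulr_rgt0 ?subr_gt0//; lra.
have s0 := sqrt3_gt0.
rewrite X; field.
by rewrite !gt_eqF//; lra.
Qed.

End Chords.

Theorem proposition1p2 (R : realType) :
  (forall t : R, 0 <= t -> t <= (Num.sqrt 6)^-1 ->
     is_maximizer t (a_bracket t) /\
     section_length (a_bracket t) t =
       (Num.sqrt 3 * (Num.sqrt (2 - 3 * t ^+ 2))^-1)%:E) /\
  (forall t : R, (Num.sqrt 6)^-1 < t -> t <= 5 / 4 * (Num.sqrt 6)^-1 ->
     is_maximizer t (a_brace t) /\
     section_length (a_brace t) t =
       ((2 * Num.sqrt 3)^-1 * (t + Num.sqrt (t ^+ 2 - 6^-1))^-1)%:E) /\
  (forall t : R, 5 / 4 * (Num.sqrt 6)^-1 <= t -> t < Num.sqrt (2 / 3) ->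
     is_maximizer t (a_one R) /\
     section_length (a_one R) t =
       (2 * Num.sqrt 2 / 3 - 2 / Num.sqrt 3 * t)%:E) /\
  (forall t : R, 0 <= t -> t <= (Num.sqrt 6)^-1 ->
     is_minimizer t (a_one R) /\
     section_length (a_one R) t =
       (2 * Num.sqrt 2 / 3 - 2 / Num.sqrt 3 * t)%:E).
Proof.
have h0 := h_gt0 R.
split=> [t t0 th|].
  have [C L] := section_length_a_bracket t0 th.
  split=> //; split=> // b Cb; rewrite L.
  have [[ht]|[z [tau [ap tt ->]]]] := section_length_cases Cb t0.
    by exfalso; lra.
  rewrite lee_fin; have -> : t ^+ 2 = tau ^+ 2.
    by case: tt => [|[]] ->; rewrite ?sqrrN.
  by apply: cut_length_le_mid => //; case: tt => [|[]]; lra.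
split=> [t ht t5|].
  have [C L] := section_length_a_brace ht t5.
  split=> //; split=> // b Cb; rewrite L.
  have t0 : 0 <= t by lra.
  have [[_ ->]|[z [tau [[hz _ _ _] tt ->]]]] := section_length_cases Cb t0.
    by rewrite lee_fin mulr_ge0 ?invr_ge0 ?mulr_ge0 ?addr_ge0 ?sqrtr_ge0.
  case: tt => [->|[_ th]]; last by exfalso; lra.
  by rewrite lee_fin; exact: cut_length_le_far.
split=> [t t5|t t0 th]; last first.
  have t2 : t <= 2 * (Num.sqrt 6)^-1 by lra.
  have L := section_length_a_one t0 t2.
  rewrite a_one_value; split=> //; split=> [|b Cb]; first exact: a_one_centered.
  rewrite L.
  have [[ht]|[z [tau [[hz z2 _ _] tt ->]]]] := section_length_cases Cb t0.
    by exfalso; lra.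
  by rewrite lee_fin; apply: cut_length_ge_end => //; case: tt => [|[]]; lra.
rewrite sqrt23 => t2; have t0 : 0 <= t by lra.
have L := section_length_a_one t0 (ltW t2).
rewrite a_one_value; split=> //; split=> [|b Cb]; first exact: a_one_centered.
rewrite L.
have [[_ ->]|[z [tau [[hz z2 _ _] tt ->]]]] := section_length_cases Cb t0.
  by rewrite lee_fin mulr_ge0 ?invr_ge0 ?sqrtr_ge0//; lra.
case: tt => [->|[_ th]]; last by exfalso; lra.
by rewrite lee_fin; apply: cut_length_le_end; lra.
Qed.
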